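(* Let $n=2m>3$ be an even integer and let $a,b$ be natural numbers with $1\le a<b\le n-1$. If $a$ and $b$ are both even and $\gcd(a+b,n)=2$, then $a$ and $b$ do not induce an $n$-polygon with $m$ axes, i.e. the $n$-tuple of sides $(a,b,a,b,\ldots,a,b)$ does not represent an $n$-polygon with $m$ axes.
   Context: Fix the vertices $v_k=e^{2\pi i k/n}$, $k=0,\ldots,n-1$, on the unit circle. An $n$-polygon is a Hamiltonian cycle through these vertices: a closed path $v_{\sigma_1}\cdots v_{\sigma_n}v_{\sigma_1}$ of straight segments with $(\sigma_1,\ldots,\sigma_n)$ an ordering of $0,\ldots,n-1$. Its sides are the integers $e_i\in\{1,\ldots,n-1\}$ with $e_i\equiv\sigma_{i+1}-\sigma_i\pmod n$; an $n$-tuple of sides represents a polygon if starting at a vertex and moving counterclockwise successively by the sides visits each vertex exactly once before returning to the start after the $n$-th step. An $n$-polygon with $m$ axes is one with exactly $m$ axes of reflection symmetry. *)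

(* Defs.v *)
From mathcomp Require Import all_boot all_order all_algebra perm.
From mathcomp Require Import complex.
From mathcomp Require Import classical_sets cardinality set_interval reals trigo.

Set Implicit Arguments.
Unset Strict Implicit.
Unset Printing Implicit Defensive.

Import Order.TTheory GRing.Theory Num.Theory.

Local Open Scope classical_set_scope.
Local Open Scope card_scope.
Local Open Scope ring_scope.
Local Open Scope complex_scope.

(* An ordering (s_1, ..., s_n) of the n vertices is a permutation s : 'S_n,
   indexed from 0; [ordS i] is the cyclic successor of i, so the closing
   segment, from the last vertex back to the first one, is included. *)

Section Plane.
Variable R : realType.
Implicit Types p u x y z : R[i].

Definition segment x y : set R[i] :=
  [set (1 - t)%:C * x + t%:C * y | t in `[0, 1]].

Definition line p u : set R[i] := [set p + t%:C * u | t in setT].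

(* For u != 0: the orthogonal reflection in [line p u]. *)
Definition reflection p u z : R[i] := p + u / u^*%C * (z - p)^*%C.

Definition vertex n (k : 'I_n) : R[i] :=
  let theta : R := 2 * pi * k%:R / n%:R in cos theta +i* sin theta.

Definition polygon n (s : 'S_n) : set (set R[i]) :=
  [set segment (vertex (s i)) (vertex (s (ordS i))) | i in setT].

(* A reflection is a symmetry of the polygon when it permutes its segments.
   Axes are counted as lines, i.e. as sets of points: a line has many
   parametrisations (p, u). *)
Definition axes n (s : 'S_n) : set (set R[i]) :=
  [set L | exists p u, [/\ u != 0, L = line p u &
     [set reflection p u @` S | S in polygon s] = polygon s]].

Definition has_axes n (s : 'S_n) (m : nat) : Prop := axes s #= `I_m.

End Plane.

(* The vertex reached from vertex k after the first j steps. *)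
Definition walk n (e : n.-tuple nat) (k j : nat) : nat :=
  ((k + sumn (take j e)) %% n)%N.

(* As s is a permutation, the last clause says that each vertex is visited
   exactly once during the steps 0, ..., n - 1, in the order given by s. *)
Definition represents n (e : n.-tuple nat) (s : 'S_n) : Prop :=
  (forall i, (1 <= tnth e i <= n - 1)%N) /\
  exists k : 'I_n, walk e k n = k /\ forall j : 'I_n, s j = walk e k j :> nat.

Definition alternating n (a b : nat) : n.-tuple nat :=
  [tuple if odd i then b else a | i < n].

Definition induces_polygon_with_axes (R : realType) (n m a b : nat) : Prop :=
  exists s : 'S_n, represents (alternating n a b) s /\ has_axes R s m.

(* Main.v *)
(** All sides and [n] are even, so every vertex visited has the parity of the
    starting vertex, and the vertices of the other parity are missed. *)

Require Import Defs.
From mathcomp Require Import all_boot all_order all_algebra perm.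
From mathcomp Require Import complex.
From mathcomp Require Import classical_sets cardinality set_interval reals trigo.

(** Parity is an invariant of the walk: partial sums of even sides are even, and reduction modulo an
    even [n] preserves parity ([odd_walk]). A permutation reaches every vertex, so 0 and 1 would
    have equal parity. *)

Lemma odd_sumn (s : seq nat) : all (predC odd) s -> odd (sumn s) = false.
Proof. by elim: s => //= x s IHs /andP[/negPf ox /IHs os]; rewrite oddD ox os. Qed.

Lemma all_even_alternating (n a b : nat) :
  ~~ odd a -> ~~ odd b -> all (predC odd) (Defs.alternating n a b).
Proof.
by move=> ea eb; apply/all_tnthP => i; rewrite tnth_mktuple; case: ifP.
Qed.

Lemma odd_walk (n : nat) (e : n.-tuple nat) (k j : nat) :
  ~~ odd n -> all (predC odd) e -> odd (walk e k j) = odd k.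
Proof.
move=> en; rewrite -{1}(cat_take_drop j e) all_cat => /andP[/odd_sumn es _].
by rewrite /walk odd_mod ?(negPf en) // oddD es addbF.
Qed.

Theorem theorem5 (R : realType) (n m a b : nat) :
  n = (2 * m)%N -> (3 < n)%N ->
  (1 <= a)%N -> (a < b)%N -> (b <= n - 1)%N ->
  ~~ odd a -> ~~ odd b -> gcdn (a + b) n = 2%N ->
  ~ induces_polygon_with_axes R n m a b.
Proof.
move=> def_n n_gt3 _ _ _ ea eb _ [s [[_ [k [_ s_walk]]] _]].
have en : ~~ odd n by rewrite def_n oddM.
have s_odd (v : 'I_n) : odd v = odd k.
  (* Surjectivity of [s]: the walk is at [v] after [s^-1 v] steps. *)
  by rewrite -(permKV s v) s_walk odd_walk ?all_even_alternating.
have n_gt1 : (1 < n)%N by apply: leq_trans n_gt3.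
(* The two ordinals are the vertices 0 and 1, of opposite parity. *)
have := s_odd (Ordinal (ltnW n_gt1)).
by rewrite -(s_odd (Ordinal n_gt1)).
Qed.
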